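(* Let $\mathcal X$ be an ordered topological vector space, let $\mathcal A\subset\mathcal X$ be an arbitrary acceptance set and $S=(S_0,S_T)$ a traded asset. (i) If $S_T\in\operatorname{core}(\mathcal X_+)$, then $\rho_{\mathcal A,S}$ is finitely valued. (ii) If $S_T\in\operatorname{int}(\mathcal X_+)$, then $\rho_{\mathcal A,S}$ is finitely valued and continuous. Moreover, if $\mathcal X$ is an ordered normed space and $S_T\in\operatorname{int}(\mathcal X_+)$, then $\rho_{\mathcal A,S}$ is Lipschitz continuous.
   Context: An ordered topological vector space $\mathcal X$ is a Hausdorff real topological vector space ordered by a pointed convex cone $\mathcal X_+$ (a cone is a set closed under multiplication by every $\lambda\ge0$; pointed means $\mathcal X_+\cap(-\mathcal X_+)=\{0\}$); $X\le Y$ means $Y-X\in\mathcal X_+$. It is an ordered normed space if its topology is given by a norm. For $\mathcal B\subset\mathcal X$, $\operatorname{int}(\mathcal B)$ is the interior and $\operatorname{core}(\mathcal B)$ (algebraic interior) is the set of $X\in\mathcal B$ such that for each $Y\in\mathcal X$ there is $\varepsilon>0$ with $X+\lambda Y\in\mathcal B$ whenever $|\lambda|<\varepsilon$. An acceptance set is a nonempty proper subset $\mathcal A\subset\mathcal X$ such that $X\in\mathcal A$ and $Y\ge X$ imply $Y\in\mathcal A$. A traded asset is a pair $S=(S_0,S_T)$ with $S_0>0$ a real number and $S_T\in\mathcal X_+$ nonzero. The associated risk measure $\rho_{\mathcal A,S}:\mathcal X\to\mathbb R\cup\{\pm\infty\}$ is $$\rho_{\mathcal A,S}(X)=\inf\{m\in\mathbb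 R : X+\tfrac{m}{S_0}S_T\in\mathcal A\},$$ with $\inf\emptyset=\infty$. *)

(* Defs.v *)
From HB Require Import structures.
From mathcomp Require Import all_boot all_order all_algebra.
From mathcomp Require Import all_classical all_reals all_analysis.

Set Implicit Arguments.
Unset Strict Implicit.
Unset Printing Implicit Defensive.

Import Order.TTheory GRing.Theory Num.Theory.
Import numFieldNormedType.Exports.

Local Open Scope classical_set_scope.
Local Open Scope ring_scope.

Section OrderedVectorSpace.
Context {R : realType} {X : lmodType R}.

Definition is_cone (B : set X) : Prop :=
  forall (l : R) (x : X), 0 <= l -> B x -> B (l *: x).

Record ordering_cone (K : set X) : Prop := {
  ordering_cone_scale : is_cone K;
  ordering_cone_convex : convex_set K;
  ordering_cone_pointed : K `&` [set - x | x in K] = [set 0] }.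

Definition cone_le (K : set X) (x y : X) : Prop := K (y - x).

Definition algebraic_interior (B : set X) : set X :=
  [set x | B x /\ forall y : X, exists2 e : R, 0 < e &
    forall l : R, `|l| < e -> B (x + l *: y)].

Record acceptance_set (K A : set X) : Prop := {
  acceptance_set_nonempty : A !=set0;
  acceptance_set_proper : A != setT;
  acceptance_set_monotone : forall x y, A x -> cone_le K x y -> A y }.

(* [S.1] is the price at time 0 and [S.2] the payoff at maturity. *)
Record traded_asset (K : set X) (S : R * X) : Prop := {
  traded_asset_price : 0 < S.1;
  traded_asset_payoff : K S.2;
  traded_asset_neq0 : S.2 != 0 }.

(* [ereal_inf set0 = +oo] *)
Definition risk_measure (A : set X) (S : R * X) (x : X) : \bar R :=
  ereal_inf [set m%:E | m in [set m : R | A (x + (m / S.1) *: S.2)]].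

End OrderedVectorSpace.

Definition finitely_valued {T : Type} {R : realType} (f : T -> \bar R) : Prop :=
  forall x, f x \is a fin_num.

(* Main.v *)
(** An interior payoff is an order unit: every [y] satisfies [c *: S.2 + y >= 0]
    for [c] large. Comparing with a point of [A] and a point outside [A] then
    bounds the risk measure from above and below, and [c *: S.2 + (x - y) >= 0]
    with [c >= 0] gives [risk_measure A S x <= risk_measure A S y + c * S.1];
    topological interiority lets [c] be small when [x - y] is small. *)
Require Import Defs.
From HB Require Import structures.
From mathcomp Require Import all_boot all_order all_algebra.
From mathcomp Require Import all_classical all_reals all_analysis.
Import Order.TTheory GRing.Theory Num.Theory.
Import numFieldNormedType.Exports.
Local Open Scope classical_set_scope.
Local Open Scope ring_scope.

Section RiskMeasure.
Context {R : realType} {X : lmodType R} {K A : set X} {S : R * X}.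
Hypotheses (coneK : is_cone K) (accA : acceptance_set K A) (S1_gt0 : 0 < S.1).

Lemma cone_scale_add (c : R) (u y : X) :
  0 < c -> K (u + c^-1 *: y) -> K (c *: u + y).
Proof.
move=> c0 /(coneK _ _ (ltW c0)).
by rewrite scalerDr scalerA mulfV ?gt_eqF// scale1r.
Qed.

Lemma algebraic_interior_order_unit (u y : X) :
  algebraic_interior K u -> exists c : R, K (c *: u + y).
Proof.
(* Halving [e] puts the scalar [e / 2] strictly inside the admissible range. *)
move=> [_ /(_ y)[e e0 Ku]]; exists (e / 2)^-1.
apply: cone_scale_add; first by rewrite invr_gt0 divr_gt0.
rewrite invrK; apply: Ku.
by rewrite gtr0_norm ?divr_gt0// ltr_pdivrMr// ltr_pMr// ltr1n.
Qed.

(** If [m] is admissible for [y], then [m + c * S.1] is admissible for [x]: the two resulting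
    positions differ by [c *: S.2 + (x - y)]. Infinite values are allowed. *)
Lemma risk_measure_le_add (c : R) (x y : X) : K (c *: S.2 + (x - y)) ->
  (risk_measure A S x <= risk_measure A S y + (c * S.1)%:E)%E.
Proof.
move=> Kxy; rewrite -leeBlDr//; apply/ereal_infP => _ [m /= Am <-].
rewrite EFinN leeBlDr//; apply: ge_ereal_inf; exists (m + c * S.1)%:E => //.
exists (m + c * S.1) => //=.
apply: acceptance_set_monotone accA _ _ Am _.
rewrite /cone_le mulrDl mulfK ?gt_eqF// scalerDl opprD addrACA.
by rewrite [_ *: _ + _ - _]addrAC subrr add0r addrC.
Qed.

Lemma risk_measure_fin_num :
  algebraic_interior K S.2 -> finitely_valued (risk_measure A S).
Proof.
move=> coreS x.
have [a Aa] := acceptance_set_nonempty accA.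
have [b nAb] : exists b, ~ A b.
  apply/existsNP => AT; move/eqP: (acceptance_set_proper accA).
  by apply; apply/seteqP; split.
have [c Kc] := algebraic_interior_order_unit _ (x - a) coreS.
have [d Kd] := algebraic_interior_order_unit _ (b - x) coreS.
rewrite fin_numElt; apply/andP; split.
(* An admissible [m < - d * S.1] would give [x + (m / S.1) *: S.2 <= x - d *: S.2 <= b] in the cone
   order, forcing [b] into [A]. *)
- apply: (@lt_le_trans _ _ (- d * S.1)%:E); first exact: ltNyr.
  apply/ereal_infP => _ [m /= Am <-]; rewrite lee_fin leNgt; apply/negP => md.
  apply: nAb; apply: (acceptance_set_monotone accA (x := x - d *: S.2)).
    apply: acceptance_set_monotone accA _ _ Am _.
    rewrite /cone_le opprD addrACA subrr add0r -opprD -scalerDl -scaleNr.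
    apply: coneK; last exact: coreS.1.
    by rewrite oppr_ge0 -lerBrDl sub0r ler_pdivrMr// ltW.
  by rewrite /cone_le opprB addrCA.
(* The amount [c * S.1] is admissible, since [x + c *: S.2] dominates [a]. *)
- apply: (@le_lt_trans _ _ (c * S.1)%:E); last exact: ltry.
  apply: ereal_inf_lbound; exists (c * S.1) => //=.
  apply: (acceptance_set_monotone accA (x := a)) => //.
  by rewrite /cone_le mulfK ?gt_eqF// addrAC addrC.
Qed.

Lemma fine_risk_measure_dist (c : R) (x y : X) :
  finitely_valued (risk_measure A S) ->
  K (c *: S.2 + (x - y)) -> K (c *: S.2 + (y - x)) ->
  `|fine (risk_measure A S x) - fine (risk_measure A S y)| <= c * S.1.
Proof.
move=> fin /risk_measure_le_add xy /risk_measure_le_add yx.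
move: xy yx; rewrite -(fineK (fin x)) -(fineK (fin y)) -!EFinD !lee_fin /=.
by move=> xy yx; rewrite ler_distlC lerBlDr xy yx.
Qed.

End RiskMeasure.

(** By continuity of the vector operations the points tend to [u], of which [K] is a neighbourhood.
    This serves both a vanishing scalar with a fixed vector and a fixed scalar with a vanishing
    vector. *)
Lemma near_interior_add_scale {R : realType} (X : topologicalLmodType R)
    (K : set X) (u : X) (T : Type) (F : set_system T) (a : T -> R^o) (f : T -> X)
    (a0 : R^o) (f0 : X) : Filter F -> K° u ->
  a @ F --> a0 -> f @ F --> f0 -> a0 *: f0 = 0 ->
  \forall t \near F, K (u + a t *: f t).
Proof.
move=> FF Ku aF fF af0.
suff : (fun t => u + a t *: f t) @ F --> u by apply.
rewrite -[X in _ --> X]addr0 -af0.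
apply: (@continuous2_cvg _ _ _ _ _ _ _ _ (fun x y : X => x + y)).
- exact: (add_continuous (_, _)).
- exact: cvg_cst.
- apply: (@continuous2_cvg _ _ _ _ _ _ _ _ (fun (x : R^o) (y : X) => x *: y)) => //.
  exact: (scale_continuous (_, _)).
Qed.

Lemma interior_algebraic_interior {R : realType} (X : topologicalLmodType R)
    (K : set X) (u : X) : K° u -> algebraic_interior K u.
Proof.
move=> Ku; split=> [|y]; first exact: interior_subset.
have /nbhs_ballP[e /= e0 Ke] : \forall l \near (0 : R^o), K (u + l *: y).
  by apply: near_interior_add_scale Ku cvg_id (cvg_cst y) (scale0r y).
exists e => // l le; apply: Ke.
by rewrite -ball_normE /= sub0r normrN.
Qed.

Lemma interior_near_cone {R : realType} (X : topologicalLmodType R)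
    (K : set X) (c : R) (u x : X) : is_cone K -> K° u -> 0 < c ->
  \forall y \near x, K (c *: u + (x - y)) /\ K (c *: u + (y - x)).
Proof.
move=> coneK Ku c0.
have yx0 : (fun y => y - x) @ x --> (0 : X).
  rewrite -[X in _ --> X](subrr x).
  apply: (@continuous2_cvg _ _ _ _ _ _ _ _ (fun a b : X => a - b)).
  - exact: (@sub_continuous _ (_, _)).
  - exact: cvg_id.
  - exact: cvg_cst.
have near_cone (r : R^o) : \forall y \near x, K (u + r *: (y - x)).
  by apply: near_interior_add_scale Ku (cvg_cst r) yx0 (scaler0 _ _).
(* Scaling by [c] turns the two signs into the two order bounds. *)
have pos := near_cone c^-1; have neg := near_cone (- c^-1).
apply: filterS2 neg pos => y neg pos; split; apply: cone_scale_add => //.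
by rewrite -opprB scalerN -scaleNr.
Qed.

Theorem proposition3p1 (R : realType) :
  (forall (X : topologicalLmodType R) (K A : set X) (S : R * X),
      hausdorff_space X -> ordering_cone K ->
      acceptance_set K A -> traded_asset K S ->
      (algebraic_interior K S.2 -> finitely_valued (risk_measure A S)) /\
      (interior K S.2 ->
        finitely_valued (risk_measure A S) /\ continuous (risk_measure A S))) /\
  (forall (X : normedModType R) (K A : set X) (S : R * X),
      ordering_cone K -> acceptance_set K A -> traded_asset K S ->
      interior K S.2 ->
      finitely_valued (risk_measure A S) /\
      [lipschitz (fine (risk_measure A S x) : R^o) | x in [set: X]]).
Proof.
split=> [X K A S _ [coneK _ _] accA [S1_gt0 _ _] | X K A S [coneK _ _] accA [S1_gt0 _ _] intS].
  split=> [coreS|intS]; first exact: risk_measure_fin_num coneK accA S1_gt0 coreS.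
  have fin := risk_measure_fin_num coneK accA S1_gt0 (interior_algebraic_interior _ _ _ intS).
  split=> // x.
  suff : risk_measure A S @ x --> (fine (risk_measure A S x))%:E by rewrite fineK.
  apply/fine_cvgP; split.
    exact: nearW.
  apply/cvgrPdist_le => e e0.
  (* With this coefficient the bound [c * S.1] is exactly [e]. *)
  have c0 : 0 < e / S.1 by rewrite divr_gt0.
  apply: filterS (interior_near_cone _ _ _ _ x coneK intS c0) => y [xy yx].
  rewrite -[leRHS](divfK (lt0r_neq0 S1_gt0)).
  exact: fine_risk_measure_dist accA S1_gt0 _ _ _ fin xy yx.
have fin := risk_measure_fin_num coneK accA S1_gt0 (interior_algebraic_interior _ _ _ intS).
split=> //.
have /nbhs_ballP[e /= e0 Ke] := intS.
(* For [z != 0] the coefficient rescales [z] to norm [e / 2], inside the ball around [S.2]; for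
   [z = 0] it vanishes and has no inverse, hence the case split. *)
have cone_ge (z : X) : K ((2 / e * `|z|) *: S.2 + z).
  have [->|z0] := eqVneq z 0.
    rewrite normr0 mulr0 scale0r addr0 -(scale0r S.2).
    by apply: coneK => //; exact: interior_subset.
  have c0 : 0 < 2 / e * `|z| by rewrite mulr_gt0 ?divr_gt0 ?normr_gt0.
  apply: cone_scale_add => //; apply: Ke.
  rewrite -ball_normE /= opprD addrA subrr add0r normrN normrZ gtr0_norm ?invr_gt0//.
  by rewrite invfM invf_div -mulrA mulVf ?normr_eq0// mulr1 ltr_pdivrMr// ltr_pMr// ltr1n.
(* Passing from an explicit Lipschitz constant to [[lipschitz _ | _ in _]] uses a proper filter;
   [(0, 0)] witnesses nonemptiness. *)
have pf : ProperFilter (globally ([set: X] `*` [set: X])).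
  by apply: (globally_properfilter (a := (0, 0))).
apply: (@klipschitzW _ _ _ (2 / e * S.1)) => -[x y] _ /=.
rewrite mulrAC.
apply: fine_risk_measure_dist accA S1_gt0 _ _ _ fin _ _ => //.
by rewrite distrC.
Qed.
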